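(* Let $\mathcal{C}$ be a formally self-dual binary linear $[n,k]$ code, and consider the scaled Construction A integral lattice $\sqrt2\,\Lambda_{\mathrm A}(\mathcal{C})=\mathcal{C}+2\mathbb{Z}^n$. Then for any $\tau>0$, $$2^{-(n-k)}\le\frac{\Theta_{\sqrt2\,\Lambda_{\mathrm A}(\mathcal{C})}(i\tau)}{\Theta_{\mathbb{Z}^n}(i\tau)}=\frac{W_{\mathcal{C}}\bigl(1+s(\tau),\,1-s(\tau)\bigr)}{2^n}\le 1,$$ where $s(\tau)=\vartheta_4(i\tau)/\vartheta_3(i\tau)$ satisfies $0\le s(\tau)\le 1$.
   Context: A binary $[n,k]$ code is a $k$-dimensional linear subspace $\mathcal{C}\subseteq\mathbb{F}_2^n$. Its weight enumerator is $W_{\mathcal{C}}(x,y)=\sum_{c\in\mathcal{C}}x^{n-w_{\mathrm H}(c)}y^{w_{\mathrm H}(c)}$, where $w_{\mathrm H}$ is the Hamming weight. The code is formally self-dual if $W_{\mathcal{C}}=W_{\mathcal{C}^\perp}$, where $\mathcal{C}^\perp$ is the dual code. In $\mathcal{C}+2\mathbb{Z}^n$ codewords are viewed as $0/1$ integer vectors, and $\Lambda_{\mathrm A}(\mathcal{C})=\frac1{\sqrt2}(\mathcal{C}+2\mathbb{Z}^n)$. For a lattice $\Lambda$ and $\tau>0$, $\Theta_\Lambda(i\tau)=\sum_{\lambda\in\Lambda}e^{-\pi\tau\|\lambda\|^2}$. The Jacobi theta functions are $\vartheta_3(i\tau)=\sum_{v\in\mathbb{Z}}e^{-\pi\tau v^2}$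 and $\vartheta_4(i\tau)=\sum_{v\in\mathbb{Z}}(-1)^v e^{-\pi\tau v^2}$. *)

(* Defs.v *)
From HB Require Import structures.
From mathcomp Require Import all_boot all_order all_algebra.
From mathcomp Require Import all_classical all_reals all_analysis.
Import Order.TTheory GRing.Theory Num.Theory.

Set Implicit Arguments.
Unset Strict Implicit.
Unset Printing Implicit Defensive.

Local Open Scope classical_set_scope.
Local Open Scope ring_scope.

Section Codes.
Variable n : nat.
Implicit Types (c : 'rV['F_2]_n) (S : {pred 'rV['F_2]_n})
  (C : {vspace 'rV['F_2]_n}).

Definition hamming_weight c : nat := #|[pred i | c 0 i != 0]|.

Definition dual_code C : {set 'rV['F_2]_n} :=
  [set x : 'rV['F_2]_n | [forall c, (c \in C) ==> (\sum_i x 0 i * c 0 i == 0)]]%SET.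

(* In [{poly {poly int}}], ['X] is the first variable x and ['X%:P] is the
   second variable y.  The sum is over an arbitrary set of words, so that it
   applies both to a subspace and to [dual_code], which is a finite set. *)
Definition weight_enumerator S : {poly {poly int}} :=
  \sum_(c in S) 'X ^+ (n - hamming_weight c) * 'X%:P ^+ hamming_weight c.

Definition weight_enumerator_eval (A : comNzRingType) S (x y : A) : A :=
  (map_poly (map_poly intr) (weight_enumerator S)).[x%:P].[y].

Lemma weight_enumerator_evalE (A : comNzRingType) S (x y : A) :
  weight_enumerator_eval S x y =
  \sum_(c in S) x ^+ (n - hamming_weight c) * y ^+ hamming_weight c.
Proof.
rewrite /weight_enumerator_eval rmorph_sum !horner_sum /=.
apply: eq_bigr => c _.
rewrite rmorphM !rmorphXn /= map_polyX map_polyC /= map_polyX.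
by rewrite !hornerE.
Qed.

Definition formally_self_dual C : Prop :=
  weight_enumerator C = weight_enumerator (dual_code C).

(* The integer representative of an entry of ['F_2] is its canonical
   representative 0 or 1. *)
Definition lift01 c : 'rV[int]_n := map_mx (fun a : 'F_2 => (a : nat)%:Z) c.

Definition code_plus_2Zn C : set 'rV[int]_n :=
  [set lift01 c + z *+ 2 | c in [set` C] & z in [set: 'rV[int]_n]].

End Codes.

Section Lattices.
Variables (R : realType) (n : nat).
Implicit Types (L : set 'rV[R]_n).

Definition embedZ (V : set 'rV[int]_n) : set 'rV[R]_n :=
  [set map_mx intr v | v in V].

Definition Zn : set 'rV[R]_n := embedZ [set: 'rV[int]_n].

Definition scale_set (a : R) L : set 'rV[R]_n := [set a *: l | l in L].

Definition constructionA (C : {vspace 'rV['F_2]_n}) : set 'rV[R]_n :=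
  scale_set (Num.sqrt 2)^-1 (embedZ (code_plus_2Zn C)).

(* Squared Euclidean norm; the library norm on ['rV[R]_n] is the sup norm. *)
Definition sqnorm (v : 'rV[R]_n) : R := \sum_i v 0 i ^+ 2.

(* The value Theta_L(i tau). *)
Definition Theta L (tau : R) : R :=
  fine (\esum_(l in L) (expR (- pi * tau * sqnorm l))%:E).

End Lattices.

Section Jacobi.
Variable R : realType.

(* [theta3 tau] and [theta4 tau] are the values at i tau. *)
Definition theta3 (tau : R) : R :=
  fine (\esum_(v in [set: int]) (expR (- pi * tau * v%:~R ^+ 2))%:E).

Definition theta4_term (tau : R) (v : int) : \bar R :=
  ((-1) ^ v * expR (- pi * tau * v%:~R ^+ 2))%:E.

(* [\esum] is meant for nonnegative terms, so the absolutely convergent signed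
   series is the difference of the sums of its positive and negative parts. *)
Definition theta4 (tau : R) : R :=
  fine (\esum_(v in [set: int]) ((theta4_term tau)^\+ v)
        - \esum_(v in [set: int]) ((theta4_term tau)^\- v))%E.

Definition theta_ratio (tau : R) : R := theta4 tau / theta3 tau.

End Jacobi.

Arguments Zn R n : clear implicits.
Arguments constructionA R {n} C.
Arguments embedZ R {n} V.

(* Main.v *)
Require Import Defs.
From HB Require Import structures.
From mathcomp Require Import all_boot all_order all_algebra finfield.
From mathcomp Require Import all_classical all_reals all_analysis.
From mathcomp Require Import ring lra zify.
Import Order.TTheory GRing.Theory Num.Theory.

(** Let [p0] and [p1] be the sums of [exp (- pi tau v^2)] over the even and the
    odd integers [v], so that [theta3 = p0 + p1] and [theta4 = p0 - p1]. A
    vector of [C + 2 Z^n] is a word [c] of [C] together with, in each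
    coordinate, an integer of the parity of [c_i]; hence the theta series is
    the sum over [c] of the products of the [p_(c_i)] ([Theta_code]), that is,
    the weight enumerator at [(p0, p1)]. Dividing by [theta3 ^ n], the theta
    series of [Z^n], and using [p0 / theta3 = (1 + s) / 2] and [p1 / theta3 =
    (1 - s) / 2] gives the identity ([Theta_ratioE]).

    The bounds depend on [0 <= s <= 1], whose substance is [p1 <= p0]. It
    follows from the duplication formulas [p0^2 = q0^2 + q1^2] and [p1^2 = 2 q0
    q1], where [q0], [q1] are the same sums at [2 tau]: they come from rotating
    and scaling the square lattice by the map [(c, d) -> (c + d, c - d)]
    ([theta_class_sqr]), and their difference is a square. This avoids the
    modular transformation of [theta4] and its product formula.

    Given [0 <= s <= 1], all terms of the weight enumerator at [(1 + s, 1 - s)]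
    are nonnegative, and the sum over all words is [2 ^ n]: this is the upper
    bound. For the lower bound the MacWilliams identity rewrites the value as
    [2 ^ k] times the weight enumerator of the dual code at [(1, s)], which is
    at least 1 because of the zero word. *)

Set Implicit Arguments.
Unset Strict Implicit.
Unset Printing Implicit Defensive.

Local Open Scope classical_set_scope.
Local Open Scope ring_scope.

(** * Weight enumerators and the MacWilliams identity *)

(** Expansion of a product of sums, with the choice functions stored as row
    vectors so that they can be read as words. *)
Lemma prod_sum_row (A : comPzSemiRingType) (T : finType) (n : nat)
    (F : 'I_n -> T -> A) :
  \prod_(i < n) \sum_(b : T) F i b =
  \sum_(v : 'rV[T]_n) \prod_(i < n) F i (v 0 i).
Proof.
rewrite bigA_distr_bigA [RHS](reindex (fun f : {ffun 'I_n -> T} => \row_i f i)).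
  by apply: eq_bigr => f _; apply: eq_bigr => i _; rewrite mxE.
exists (fun v : 'rV[T]_n => [ffun i => v 0 i]) => [f _|v _].
  by apply/ffunP => i; rewrite ffunE mxE.
by apply/rowP => i; rewrite mxE ffunE.
Qed.

Lemma weight_monomialE (A : comNzRingType) (n : nat) (c : 'rV['F_2]_n)
    (x y : A) :
  x ^+ (n - hamming_weight c) * y ^+ hamming_weight c =
  \prod_(i < n) (if c 0 i == 0 then x else y).
Proof.
rewrite (bigID (fun i => c 0 i == 0)) /=; congr (_ * _).
  rewrite (eq_bigr (fun=> x)) => [|i ->//]; rewrite prodr_const.
  have := cardC [pred i | c 0 i != 0]; rewrite card_ord => {1}<-.
  rewrite /hamming_weight addKn; congr (_ ^+ _); apply: eq_card => i.
  by rewrite !inE negbK.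
by rewrite (eq_bigr (fun=> y)) => [|i /negbTE ->//]; rewrite prodr_const.
Qed.

Lemma F2P (a : 'F_2) : a = 0 \/ a = 1.
Proof. by case: a => [[|[|//]] ?]; [left|right]; apply/val_inj. Qed.

Lemma sum_F2 (V : nmodType) (F : 'F_2 -> V) : \sum_(b : 'F_2) F b = F 0 + F 1.
Proof.
rewrite big_ord_recl big_ord1.
by congr (F _ + F _); apply/val_inj.
Qed.

(** The nontrivial additive character of the field with two elements. *)
Definition F2char (A : pzRingType) (a : 'F_2) : A := (-1) ^+ (a : nat).

Lemma F2charD (A : pzRingType) : {morph F2char A : a b / a + b >-> a * b}.
Proof.
move=> a b; rewrite /F2char.
by case: (F2P a) => ->; case: (F2P b) => -> /=;
  rewrite ?expr0 ?expr1 ?mulr1 ?mul1r ?mulrNN ?mulr1.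
Qed.

Lemma F2char_sum (A : comPzRingType) n (F : 'I_n -> 'F_2) :
  F2char A (\sum_i F i) = \prod_i F2char A (F i).
Proof.
by apply: (big_morph (F2char A) (@F2charD A)); rewrite /F2char expr0.
Qed.

(** Orthogonality: if some word [c0] of the code has [b . c0 = 1], translation
    by [c0] permutes the code and negates every term, so the sum is its own
    opposite. *)
Lemma sum_F2char_code (A : numDomainType) n (C : {vspace 'rV['F_2]_n})
    (b : 'rV['F_2]_n) :
  \sum_(c in C) F2char A (\sum_i b 0 i * c 0 i) =
  (if b \in dual_code C then #|C|%:R else 0).
Proof.
rewrite inE; case: ifPn => [/forallP bC|/forallPn[c0]].
  rewrite (eq_bigr (fun=> 1)) ?sumr_const// => c cC.
  by move: (bC c); rewrite cC => /eqP ->; rewrite /F2char expr0.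
rewrite negb_imply => /andP[c0C bc0].
set S := (LHS); suff : S = - S.
  by move=> /eqP; rewrite -addr_eq0 -mulr2n mulrn_eq0 => /eqP.
rewrite /S [LHS](reindex_inj (addIr c0)) /= -sumrN.
apply: eq_big => [c|c _]; first by rewrite rpredDr.
under eq_bigr do rewrite mxE mulrDr.
rewrite big_split /= F2charD.
by case: (F2P (\sum_i b 0 i * c0 0 i)) bc0 => ->;
  rewrite ?eqxx// /F2char expr1 mulrN1.
Qed.

(** In each coordinate [x +- y] is the Fourier transform over ['F_2] of the
    function with values [x] at 0 and [y] at 1. Expanding the product over the
    coordinates gives a sum over all words [b]; exchanging the two sums leaves,
    for each [b], a character sum over the code. *)
Lemma MacWilliams (A : numDomainType) n (C : {vspace 'rV['F_2]_n}) (x y : A) :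
  weight_enumerator_eval C (x + y) (x - y) =
  #|C|%:R * weight_enumerator_eval (dual_code C) x y.
Proof.
rewrite !weight_enumerator_evalE.
transitivity (\sum_(c in C) \sum_(b : 'rV['F_2]_n)
   F2char A (\sum_i b 0 i * c 0 i) * \prod_i (if b 0 i == 0 then x else y)).
  apply: eq_bigr => c _; rewrite weight_monomialE.
  under [RHS]eq_bigr do rewrite F2char_sum -big_split /=.
  rewrite -(@prod_sum_row _ _ _
    (fun i b => F2char A (b * c 0 i) * (if b == 0 then x else y))).
  apply: eq_bigr => i _; rewrite sum_F2 mul0r mul1r /=.
  by case: (F2P (c 0 i)) => ->;
    rewrite ?eqxx ?oner_eq0 /F2char !(expr0, expr1) ?mul1r ?mulN1r.
rewrite exchange_big /= mulr_sumr [RHS]big_mkcond; apply: eq_bigr => b _.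
rewrite -mulr_suml sum_F2char_code weight_monomialE.
by case: ifP => _; rewrite ?mul0r.
Qed.

(** The right-hand side is the same sum of nonnegative terms over all words. *)
Lemma weight_enumerator_eval_le_exp (A : numDomainType) n
    (C : {vspace 'rV['F_2]_n}) (x y : A) : 0 <= x -> 0 <= y ->
  weight_enumerator_eval C x y <= (x + y) ^+ n.
Proof.
move=> x0 y0; rewrite weight_enumerator_evalE.
have -> : (x + y) ^+ n =
    \sum_(c : 'rV['F_2]_n) \prod_i (if c 0 i == 0 then x else y).
  rewrite -(@prod_sum_row _ _ _ (fun=> fun b => if b == 0 then x else y)).
  by under eq_bigr do rewrite sum_F2 /=; rewrite prodr_const card_ord.
under eq_bigr do rewrite weight_monomialE.
rewrite [leLHS]big_mkcond; apply: ler_sum => c _; case: ifP => // _.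
by apply: prodr_ge0 => i _; case: ifP.
Qed.

(** MacWilliams turns the value into [#|C|] times that of the dual code at [(1,
    s)], where the zero word contributes 1 and no term is negative. *)
Lemma weight_enumerator_eval_ge (A : numDomainType) n
    (C : {vspace 'rV['F_2]_n}) (s : A) : 0 <= s ->
  2 ^+ \dim C <= weight_enumerator_eval C (1 + s) (1 - s).
Proof.
move=> s0; rewrite MacWilliams card_vspace card_Fp// natrX.
rewrite ler_peMr ?exprn_ge0// weight_enumerator_evalE.
have dual0 : 0 \in dual_code C.
  rewrite inE; apply/forallP => c; apply/implyP => _.
  by rewrite big1// => i _; rewrite mxE mul0r.
rewrite (bigD1 0)//= weight_monomialE big1 => [|i _]; last by rewrite mxE eqxx.
by rewrite lerDl; apply: sumr_ge0 => c _; rewrite expr1n mul1r exprn_ge0.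
Qed.

(** * Products and finiteness of unordered sums *)

Section Esum.
Variable R : realType.

(** The library sum takes values in the extended reals; this predicate also
    records finiteness, so that products and finite sums of values can be taken
    in [R]. *)
Definition has_esum (T : choiceType) (f : T -> R) (s : R) : Prop :=
  \esum_(x in [set: T]) (f x)%:E = s%:E.

Lemma esumZl (T : choiceType) (S : set T) (a : R) (f : T -> \bar R) :
  0 <= a -> (forall x, S x -> 0 <= f x)%E ->
  \esum_(x in S) (a%:E * f x)%E = (a%:E * \esum_(x in S) f x)%E.
Proof.
move=> a0 f0; rewrite /esum -ereal_supZl//; last first.
  by apply/set0P; exists 0%E; exists set0; rewrite ?fsbig_set0//;
    exact: fsets_set0.
have E A : fsets S A ->
    \sum_(x \in A) (a%:E * f x)%E = (a%:E * \sum_(x \in A) f x)%E.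
  move=> [finA AS]; rewrite !fsbig_finite//= big_seq [in RHS]big_seq.
  rewrite ge0_sume_distrr//.
  by move=> i; rewrite in_fset_set// inE => /AS/f0.
congr ereal_sup; apply/seteqP; split => [_ [A SA <-]|_ [_ [A SA <-] <-]].
  by exists (\sum_(x \in A) f x); [exists A|rewrite E].
by exists A => //; rewrite E.
Qed.

Lemma has_esum_prod (T U : choiceType) (f : T -> R) (g : U -> R) s t :
  (forall x, 0 <= f x) -> (forall y, 0 <= g y) ->
  has_esum f s -> has_esum g t ->
  has_esum (fun xy : T * U => f xy.1 * g xy.2) (s * t).
Proof.
move=> f0 g0 fs gt; rewrite /has_esum.
have -> : [set: T * U] = [set: T] `*`` (fun=> [set: U]) by apply/seteqP; split.
rewrite -(esum_esum (a := fun x y => (f x * g y)%:E)); last first.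
  by move=> x y _ _; rewrite lee_fin mulr_ge0.
under eq_esum => x _.
  under eq_esum do rewrite EFinM.
  rewrite esumZl// ?gt; last by move=> y _; rewrite lee_fin.
  rewrite muleC.
  over.
have t0 : 0 <= t.
  by rewrite -lee_fin -gt; apply: esum_ge0 => y _; rewrite lee_fin.
rewrite esumZl//; last by move=> x _; rewrite lee_fin.
by rewrite fs -EFinM mulrC.
Qed.

Lemma has_esum_bij (T U : choiceType) (h : T -> U) (k : U -> T) (f : U -> R) s :
  cancel h k -> cancel k h -> has_esum (f \o h) s -> has_esum f s.
Proof.
move=> hK kK fs; rewrite /has_esum (@reindex_esum _ _ _ [set: T] _ h)//.
split=> // [x y _ _ /(can_inj hK)//|y _]; by exists (k y).
Qed.

(** A sum over vectors of a product of functions of one coordinate factors: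
    split off the first coordinate and use the product rule for two series. *)
Lemma has_esum_row (T : zmodType) n (f : 'I_n -> T -> R) (s : 'I_n -> R) :
  (forall i x, 0 <= f i x) -> (forall i, has_esum (f i) (s i)) ->
  has_esum (fun v : 'rV[T]_n => \prod_i f i (v 0 i)) (\prod_i s i).
Proof.
elim: n f s => [|n IHn] f s f0 fs.
  rewrite /has_esum (_ : [set: 'rV[T]_0] = [set 0]); last first.
    by apply/seteqP; split => // v _; rewrite /= [v]thinmx0.
  by rewrite esum_set1 !big_ord0.
pose cons (xv : T * 'rV[T]_n) : 'rV[T]_n.+1 :=
  \row_i if unlift ord0 i is Some j then xv.2 0 j else xv.1.
pose uncons (w : 'rV[T]_n.+1) := (w 0 ord0, \row_j w 0 (lift ord0 j)).
apply: (@has_esum_bij _ _ cons uncons) => [[x v]|w|].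
- rewrite /uncons /cons mxE unlift_none; congr pair.
  by apply/rowP => j; rewrite !mxE liftK.
- by apply/rowP => i; rewrite mxE; case: unliftP => [j ->|->]; rewrite ?mxE.
rewrite big_ord_recl /comp.
rewrite [X in has_esum X _](_ : _ = fun xv : T * 'rV[T]_n =>
    f ord0 xv.1 * \prod_j f (lift ord0 j) (xv.2 0 j)); last first.
  apply/funext => -[x v]; rewrite big_ord_recl mxE unlift_none; congr (_ * _).
  by apply: eq_bigr => j _; rewrite mxE liftK.
apply: (@has_esum_prod T 'rV[T]_n (f ord0)
  (fun v => \prod_j f (lift ord0 j) (v 0 j))) => //.
  by move=> v; apply: prodr_ge0.
by apply: (IHn (fun j => f (lift ord0 j)) (fun j => s (lift ord0 j))) =>
  [i x|i]; [exact: f0|exact: fs].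
Qed.

Lemma has_esum_sum (T : choiceType) (I : finType) (P : pred I)
    (f : I -> T -> R) (s : I -> R) :
  (forall i x, P i -> 0 <= f i x) -> (forall i, P i -> has_esum (f i) (s i)) ->
  has_esum (fun x => \sum_(i | P i) f i x) (\sum_(i | P i) s i).
Proof.
move=> f0 fs; rewrite /has_esum; under eq_esum do rewrite -sumEFin.
rewrite esum_sum; last by move=> x i _ Pi; rewrite lee_fin f0.
by rewrite -sumEFin; apply: eq_bigr => i Pi; apply: fs.
Qed.

(** The sum over the integers is split into two one-sided geometric series,
    along the two constructors of [int]. *)
Lemma esum_int_geometric_lt (q : R) : 0 <= q < 1 ->
  (\esum_(v in [set: int]) (q ^+ `|v|)%:E < +oo)%E.
Proof.
move=> /andP[q0 q1].
have geom (e : nat -> int) : (forall n, n <= `|e n|)%N -> injective e ->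
    (\esum_(v in range e) (q ^+ `|v|)%:E < +oo)%E.
  move=> ge_e inj_e; rewrite esum_image; last by move=> ? ? _ _; apply: inj_e.
  rewrite -nneseries_esumT; last by move=> n; rewrite lee_fin exprn_ge0.
  apply: (@le_lt_trans _ _ ((1 - q)^-1)%:E); last exact: ltry.
  apply: lime_le; first by apply: is_cvg_nneseries => *;
    rewrite lee_fin exprn_ge0.
  apply: nearW => n; rewrite sumEFin lee_fin.
  apply: (@le_trans _ _ (\sum_(0 <= k < n) q ^+ k)).
    by apply: ler_sum => k _; apply: ler_wiXn2l => //; exact: ltW.
  have q1' : 0 < 1 - q by rewrite subr_gt0.
  rewrite -[leRHS]mul1r ler_pdivlMr// mulrC -opprB mulNr big_mkord.
  rewrite -subrX1 opprB.
  by rewrite lerBlDr lerDl exprn_ge0.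
rewrite (esumID (range Posz)) => [|v _]; last by rewrite lee_fin exprn_ge0.
rewrite !setTI (_ : ~` range Posz = range Negz); last first.
  apply/seteqP; split => [[n []|n _]|_ [n _ <-] []] //; by exists n.
by rewrite lte_add_pinfty// geom// => ? ? [].
Qed.

End Esum.

(** * Gaussian sums over a class modulo 2 *)

Lemma intF2_eq0 (v : int) : (v%:~R == 0 :> 'F_2) = (2 %| v)%Z.
Proof. by rewrite -(@dvdz_pcharf 'F_2 2 (pchar_Fp _)). Qed.

Lemma signz_parity (A : unitRingType) (v : int) :
  (-1) ^ v = (v%:~R == 0 :> 'F_2)%:R - (v%:~R == 1 :> 'F_2)%:R :> A.
Proof.
have -> : (v%:~R == 1 :> 'F_2) = ~~ (v%:~R == 0 :> 'F_2).
  by case: (F2P v%:~R) => ->.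
have -> : (-1) ^ v = (-1) ^+ `|v| :> A.
  by case: v => n //=; rewrite NegzE -exprz_inv invrN1.
rewrite intF2_eq0 dvdzE dvdn2 -signr_odd negbK.
by case: odd; rewrite ?expr0 ?expr1 ?sub0r ?subr0.
Qed.

Section Parity.
Variable R : realType.

Definition gauss (tau : R) (v : int) : R := expR (- pi * tau * v%:~R ^+ 2).

(** The restriction of [f] to one class modulo 2, extended by zero: the sums
    over the even, the odd and all integers then share one index set. *)
Definition parity_part (f : int -> R) (a : 'F_2) (v : int) : R :=
  (v%:~R == a)%:R * f v.

Definition theta_class (tau : R) (a : 'F_2) : R :=
  fine (\esum_(v in [set: int]) (parity_part (gauss tau) a v)%:E).

Lemma parity_part_gauss_ge0 tau a v : 0 <= parity_part (gauss tau) a v.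
Proof. by rewrite mulr_ge0// expR_ge0. Qed.

(** Since [|v| <= v ^ 2] on integers, the terms are dominated by the geometric
    ones [q ^ |v|] with [q = exp (- pi tau)]. *)
Lemma gauss_summable (tau : R) : 0 < tau ->
  (\esum_(v in [set: int]) (gauss tau v)%:E < +oo)%E.
Proof.
move=> tau0; set q := expR (- (pi * tau)).
have q01 : 0 <= q < 1.
  by rewrite expR_ge0 expR_lt1 oppr_lt0 mulr_gt0// pi_gt0.
apply: le_lt_trans (esum_int_geometric_lt q01); apply: le_esum => v _.
have le_sqr : `|v|%:R <= v%:~R ^+ 2 :> R.
  by rewrite pmulrn -rmorphXn ler_int; nia.
rewrite lee_fin /gauss /q -expRM_natl ler_expR mulrN !mulNr lerN2 mulrC.
by rewrite ler_wpM2l// mulr_ge0 ?pi_ge0 ?ltW.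
Qed.

Lemma has_esum_theta_class (tau : R) a : 0 < tau ->
  has_esum (parity_part (gauss tau) a) (theta_class tau a).
Proof.
move=> tau0; rewrite /has_esum /theta_class fineK// ge0_fin_numE; last first.
  by apply: esum_ge0 => v _; rewrite lee_fin parity_part_gauss_ge0.
apply: le_lt_trans (gauss_summable tau0); apply: le_esum => v _.
by rewrite lee_fin /parity_part; case: eqP; rewrite ?mul1r// mul0r expR_ge0.
Qed.

Lemma theta_class_ge0 tau a : 0 <= theta_class tau a.
Proof.
by apply/fine_ge0/esum_ge0 => v _; rewrite lee_fin parity_part_gauss_ge0.
Qed.

Lemma theta_class0_gt0 tau : 0 < tau -> 0 < theta_class tau 0.
Proof.
move=> tau0; apply: (@lt_le_trans _ _ 1) => //.
(* The term at [v = 0] is 1. *)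
rewrite -lee_fin -has_esum_theta_class//; apply: esum_ge.
exists [set 0]; first by split => //; exact: finite_set1.
by rewrite fsbig_set1 /parity_part /gauss expr0n/= mulr0 expR0 mulr1.
Qed.

Lemma theta3E tau : 0 < tau ->
  theta3 tau = theta_class tau 0 + theta_class tau 1.
Proof.
move=> tau0; rewrite /theta3.
have <- : (theta_class tau 0)%:E + (theta_class tau 1)%:E =
   (\esum_(v in [set: int]) (gauss tau v)%:E).
  rewrite -!has_esum_theta_class// -esumD.
  - apply: eq_esum => v _; rewrite -EFinD /parity_part.
    case: (F2P v%:~R) => ->; rewrite !(eqxx, oner_eq0);
      by rewrite ?[0 == 1]eq_sym ?oner_eq0 !(mul1r, mul0r, addr0, add0r).
  - by move=> v _; rewrite lee_fin parity_part_gauss_ge0.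
  - by move=> v _; rewrite lee_fin parity_part_gauss_ge0.
by [].
Qed.

(** The positive and negative parts of the signed series are its even and odd
    terms; both converge, so [esumB] turns the definition into a difference. *)
Lemma theta4E tau : 0 < tau ->
  theta4 tau = theta_class tau 0 - theta_class tau 1.
Proof.
move=> tau0; rewrite /theta4.
have -> : theta4_term tau = (fun v =>
  (parity_part (gauss tau) 0 v)%:E - (parity_part (gauss tau) 1 v)%:E)%E.
  apply/funext => v.
  by rewrite /theta4_term signz_parity mulrBl.
have summ a : summable [set: int] (fun v => (parity_part (gauss tau) a v)%:E).
  rewrite /summable; under eq_esum do
    rewrite gee0_abs ?lee_fin ?parity_part_gauss_ge0//.
  by rewrite has_esum_theta_class// ltry.
rewrite esumB// => [|v _|v _]; try by rewrite lee_fin parity_part_gauss_ge0.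
by rewrite !has_esum_theta_class.
Qed.

(** The substitution [x = c + d], [y = c - d] maps the pairs with [c + d = a
    mod 2] bijectively onto the pairs with both entries [a mod 2], and [x^2 +
    y^2 = 2 (c^2 + d^2)]. Sorting the pairs [(c, d)] by the class [b] of [c]
    gives the convolution on the right. *)
Lemma theta_class_sqr tau a : 0 < tau ->
  theta_class tau a ^+ 2 =
  \sum_(b : 'F_2) theta_class (2 * tau) b * theta_class (2 * tau) (a - b).
Proof.
move=> tau0; have tau20 : 0 < 2 * tau by rewrite mulr_gt0.
pose g xy := gauss tau xy.1 * gauss tau xy.2.
pose Q := [set xy : int * int | xy.1%:~R = a /\ xy.2%:~R = a].
pose P := [set cd : int * int | (cd.1 + cd.2)%:~R = a].
pose h (cd : int * int) := (cd.1 + cd.2, cd.1 - cd.2).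
have lhs : (\esum_(xy in Q) (g xy)%:E = (theta_class tau a ^+ 2)%:E)%E.
  rewrite expr2 esum_mkcond -(has_esum_prod _ _ (has_esum_theta_class a tau0)
    (has_esum_theta_class a tau0)); try exact: parity_part_gauss_ge0.
  apply: eq_esum => -[x y] _; rewrite /parity_part /g /=.
  case: ifPn => [|nQ].
    by rewrite inE => -[/= -> ->]; rewrite eqxx !mul1r.
  case: eqP => [xa|]; rewrite ?mul0r//.
  case: eqP => [ya|]; rewrite ?mul0r ?mulr0//.
  by move: nQ; rewrite notin_setE; case.
have rhs : (\esum_(cd in P) (g (h cd))%:E =
    (\sum_(b : 'F_2)
        theta_class (2 * tau) b * theta_class (2 * tau) (a - b))%:E)%E.
  rewrite esum_mkcond.
  have := @has_esum_sum R (int * int)%type 'F_2 predT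
    (fun b cd => parity_part (gauss (2 * tau)) b cd.1 *
                 parity_part (gauss (2 * tau)) (a - b) cd.2)
    (fun b => theta_class (2 * tau) b * theta_class (2 * tau) (a - b)).
  move=> <-; first last.
  - by move=> b _; apply: has_esum_prod; try exact: parity_part_gauss_ge0;
      exact: has_esum_theta_class.
  - by move=> b cd _; rewrite mulr_ge0 ?parity_part_gauss_ge0.
  apply: eq_esum => -[c d] _; rewrite (bigD1 c%:~R)//= big1 ?addr0; last first.
    by move=> b /negbTE bc; rewrite /parity_part eq_sym bc !mul0r.
  rewrite /parity_part eqxx mul1r.
  have -> : ((c, d) \in P) = (d%:~R == a - c%:~R).
    apply/idP/eqP; rewrite inE /P /= rmorphD /=; first by move=> <-; ring.
    by move=> ->; ring.
  case: eqP => _; last by rewrite mul0r mulr0.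
  rewrite mul1r /g /gauss /= -!expRD; congr (expR _)%:E.
  by rewrite rmorphB rmorphD /=; ring.
apply: EFin_inj; rewrite -lhs -rhs; apply: reindex_esum; split.
- move=> [c d] /= Pcd; split => //=; rewrite -Pcd rmorphB rmorphD /=.
  by congr (_ + _); case: (F2P d%:~R) => ->; apply/val_inj.
- by move=> [c d] [c' d'] _ _ [/= ? ?]; congr pair; lia.
- move=> [x y] [/= xa ya].
  (* [c] is half of [x + y], which is even as both entries lie in one class. *)
  have /dvdzP [c xyc] : (2 %| x + y)%Z.
    rewrite -intF2_eq0 rmorphD /= xa ya.
    by case: (F2P a) => ->.
  by exists (c, x - c); rewrite /P /h/= ?subrKC//; congr pair; lia.
Qed.

End Parity.

(** * Theta series of Construction A lattices *)

Lemma lift01K n (c : 'rV['F_2]_n) : map_mx intr (lift01 c) = c.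
Proof.
by apply/rowP => i; rewrite !mxE; case: (F2P (c 0 i)) => ->; apply/val_inj.
Qed.

Lemma code_plus_2ZnP n (C : {vspace 'rV['F_2]_n}) (v : 'rV[int]_n) :
  code_plus_2Zn C v <-> map_mx intr v \in C.
Proof.
split=> [[c cC [z _ <-]]|vC].
  rewrite map_mxD lift01K (_ : map_mx _ (z *+ 2) = 0) ?addr0//.
  apply/rowP => i; rewrite mulr2n map_mxD !mxE /=.
  by case: (F2P (z 0 i)%:~R) => ->; apply/val_inj.
have /choice[z zE] (i : 'I_n) :
    exists z, v 0 i - lift01 (map_mx intr v) 0 i = z * 2.
  apply/dvdzP; rewrite -intF2_eq0 rmorphB /= subr_eq0; apply/eqP.
  by have /rowP/(_ i) := lift01K (map_mx intr v); rewrite !mxE.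
exists (map_mx intr v) => //; exists (\row_i z i) => //.
apply/rowP => i; have := zE i; rewrite mulr2n !mxE mulrDr mulr1 => <-.
by rewrite addrC subrK.
Qed.

Section Lattice.
Variable R : realType.

Lemma Theta_embedZ n (V : set 'rV[int]_n) (tau : R) :
  Theta (embedZ R V) tau =
  fine (\esum_(v in V) (\prod_i gauss tau (v 0 i))%:E).
Proof.
rewrite /Theta esum_image; last first.
  move=> v w _ _ /rowP vw; apply/rowP => i.
  by have := vw i; rewrite !mxE => /intr_inj.
congr fine; apply: eq_esum => v _; congr EFin.
rewrite /gauss -expR_sum /sqnorm mulr_sumr; congr expR.
by apply: eq_bigr => i _; rewrite mxE.
Qed.

(** Each lattice vector lies over exactly one word, its reduction modulo 2, so
    the sum splits over the words of [C]; over a fixed word [c] the coordinates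
    vary independently, each in the class of [c 0 i]. *)
Lemma Theta_code n (C : {vspace 'rV['F_2]_n}) (tau : R) : 0 < tau ->
  Theta (embedZ R (code_plus_2Zn C)) tau =
  \sum_(c in C) \prod_i theta_class tau (c 0 i).
Proof.
move=> tau0; rewrite Theta_embedZ esum_mkcond -[RHS]/(fine (_)%:E).
have <- // := @has_esum_sum R 'rV[int]_n 'rV['F_2]_n (mem C)
  (fun c v => \prod_i parity_part (gauss tau) (c 0 i) (v 0 i))
  (fun c => \prod_i theta_class tau (c 0 i)).
- congr fine; apply: eq_esum => v _.
  (* Only the reduction of [v] contributes to the sum over the code. *)
  have zero (c : 'rV['F_2]_n) : c != map_mx intr v ->
      \prod_i parity_part (gauss tau) (c 0 i) (v 0 i) = 0.
    move=> /eqP cv; apply/eqP; apply: contra_notT cv => /prodf_neq0 nz.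
    apply/rowP => i; have := nz i isT.
    by rewrite mxE /parity_part; case: (_ =P c 0 i) => [->|]//;
      rewrite mul0r eqxx.
  case: ifPn => [|nv].
    rewrite inE => /code_plus_2ZnP vC.
    rewrite (bigD1 (map_mx intr v)) //= [X in _ + X]big1 ?addr0; last first.
      by move=> c /andP[_ cv]; exact: zero.
    by congr EFin; apply: eq_bigr => i _; rewrite /parity_part mxE eqxx mul1r.
  rewrite big1// => c cC; apply: zero; apply: contraNneq nv => cv.
  by rewrite inE; apply/code_plus_2ZnP; rewrite -cv.
- by move=> c v _; apply: prodr_ge0 => i _; exact: parity_part_gauss_ge0.
- move=> c _; apply: (@has_esum_row R int n
    (fun i => parity_part (gauss tau) (c 0 i))) => [i v|i].
    exact: parity_part_gauss_ge0.
  exact: has_esum_theta_class.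
Qed.

(** [Z^n] is Construction A applied to the code of all words. *)
Lemma Theta_Zn n (tau : R) : 0 < tau -> Theta (Zn R n) tau = theta3 tau ^+ n.
Proof.
move=> tau0.
have -> : Zn R n = embedZ R (code_plus_2Zn fullv).
  congr embedZ; apply/seteqP; split => // v _.
  by apply/code_plus_2ZnP; rewrite memvf.
rewrite Theta_code// theta3E// -[in RHS](card_ord n) -prodr_const.
under [RHS]eq_bigr do rewrite -sum_F2.
rewrite prod_sum_row; apply: eq_bigl => c.
by rewrite memvf.
Qed.

Lemma theta3_gt0 (tau : R) : 0 < tau -> 0 < theta3 tau.
Proof.
by move=> tau0; rewrite theta3E// ltr_wpDr ?theta_class_ge0 ?theta_class0_gt0.
Qed.

(** The upper bound holds because the odd class contributes [theta3] and
    [theta4] with opposite signs. The lower bound says that the even class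
    dominates the odd one: with [p] and [q] the classes at [2 tau],
    [theta_class_sqr] gives squares [p^2 + q^2] and [2 p q], whose difference
    is [(p - q)^2]. *)
Lemma theta_ratio_itv (tau : R) : 0 < tau -> 0 <= theta_ratio tau <= 1.
Proof.
move=> tau0; rewrite /theta_ratio ler_pdivlMr ?mul0r ?ler_pdivrMr ?theta3_gt0//.
rewrite mul1r theta3E// theta4E// subr_ge0.
apply/andP; split; last by rewrite lerD2l ge0_cp ?theta_class_ge0.
rewrite -(@ler_pXn2r _ 2) ?nnegrE ?theta_class_ge0//.
rewrite -subr_ge0 !theta_class_sqr// !sum_F2.
have -> : 0 - 1 = 1 :> 'F_2 by apply/val_inj.
rewrite !subr0 subrr; set p := theta_class _ 0; set q := theta_class _ 1.
have -> : p * p + q * q - (p * q + q * p) = (p - q) ^+ 2 by ring.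
exact: sqr_ge0.
Qed.

Lemma Theta_ratioE n (C : {vspace 'rV['F_2]_n}) (tau : R) : 0 < tau ->
  Theta (embedZ R (code_plus_2Zn C)) tau / Theta (Zn R n) tau =
  weight_enumerator_eval C (1 + theta_ratio tau) (1 - theta_ratio tau) / 2 ^+ n.
Proof.
move=> tau0; rewrite Theta_Zn// Theta_code// weight_enumerator_evalE !mulr_suml.
have t3 := lt0r_neq0 (theta3_gt0 tau0).
apply: eq_bigr => c _; rewrite weight_monomialE.
have div_pow (F : 'I_n -> R) (x : R) :
    (\prod_i F i) / x ^+ n = \prod_i (F i / x).
  by rewrite big_split /= prodr_const card_ord exprVn.
rewrite !div_pow; apply: eq_bigr => i _.
have E0 : theta_class tau 0 = (theta3 tau + theta4 tau) / 2.
  by rewrite theta3E// theta4E//; field.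
have E1 : theta_class tau 1 = (theta3 tau - theta4 tau) / 2.
  by rewrite theta3E// theta4E//; field.
by case: (F2P (c 0 i)) => -> /=; rewrite /theta_ratio ?E0 ?E1; field.
Qed.

End Lattice.

Lemma scale_setK (R : realType) n (a : R) (L : set 'rV[R]_n) :
  a != 0 -> scale_set a (scale_set a^-1 L) = L.
Proof.
move=> a0; rewrite /scale_set image_comp -[RHS]image_id.
by apply: eq_imagel => v _ /=; rewrite scalerA divff// scale1r.
Qed.

Theorem theorem5 (R : realType) (n k : nat) (C : {vspace 'rV['F_2]_n})
    (dimC : \dim C = k) (fsdC : formally_self_dual C) :
  scale_set (Num.sqrt 2) (constructionA R C) = embedZ R (code_plus_2Zn C) /\
  forall tau : R, 0 < tau ->
    let ratio := Theta (scale_set (Num.sqrt 2) (constructionA R C)) tau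
                 / Theta (Zn R n) tau in
    let s := theta_ratio tau in
    [/\ 2 ^- (n - k) <= ratio,
        ratio = weight_enumerator_eval C (1 + s) (1 - s) / 2 ^+ n,
        weight_enumerator_eval C (1 + s) (1 - s) / 2 ^+ n <= 1
      & 0 <= s <= 1].
Proof.
have rescale : scale_set (Num.sqrt 2) (constructionA R C) =
    embedZ R (code_plus_2Zn C).
  by apply: scale_setK; rewrite gt_eqF// sqrtr_gt0.
split=> // tau tau0 ratio s.
have s01 : 0 <= s <= 1 by exact: theta_ratio_itv.
have /andP[s0 s1] := s01.
have ratioE : ratio = weight_enumerator_eval C (1 + s) (1 - s) / 2 ^+ n.
  by rewrite /ratio rescale Theta_ratioE.
have two_n : 0 < 2 ^+ n :> R by rewrite exprn_gt0.
split=> //.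
  have k_le_n : (k <= n)%N.
    by rewrite -dimC (leq_trans (dimvS (subvf C)))// dimvf /dim/= mul1n.
  rewrite ratioE ler_pdivlMr// -[in 2 ^+ n](subnK k_le_n) exprD mulKf.
    by rewrite -dimC weight_enumerator_eval_ge.
  by rewrite gt_eqF// exprn_gt0.
rewrite ler_pdivrMr// mul1r.
have -> : (2 : R) = (1 + s) + (1 - s) by ring.
by apply: weight_enumerator_eval_le_exp; lra.
Qed.
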